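(* Let $\mathcal{T}_1,\mathcal{T}_2\in\mathbf{HC}(\mathbb{S}^d)$ be two hyper projection operators. Then the sum $\mathcal{T}_1+\mathcal{T}_2$ is also a hyper projection operator if and only if $\mathcal{T}_1\mathcal{T}_2=0$; likewise, $\mathcal{T}_1+\mathcal{T}_2$ is a hyper projection operator if and only if $\mathcal{T}_2\mathcal{T}_1=0$.
   Context: Let $d\ge2$ and let $\mathbb{S}^d\subset\mathbb{R}^{d+1}$ be the unit sphere with Lebesgue surface measure $\mathrm{d}\omega_d$. $\mathcal{C}(\mathbb{S}^d)$ is the space of real continuous functions on $\mathbb{S}^d$; $\mathbb{P}_n(\mathbb{S}^d)$ is the space of restrictions to $\mathbb{S}^d$ of real polynomials of total degree at most $n$. For each $\ell\ge0$, $\{Y^{(d)}_{\ell k}:k=1,\dots,Z(d,\ell)\}$ is a fixed real $L_2(\mathbb{S}^d)$-orthonormal basis of the space of real spherical harmonics of degree $\ell$ (restrictions to $\mathbb{S}^d$ of real harmonic homogeneous polynomials of degree $\ell$), whose dimension is $Z(d,\ell)$. Fix a quadrature rule with nodes $\mathbf{x}_1,\dots,\mathbf{x}_N\in\mathbb{S}^d$ and positive weights $w_1,\dots,w_N$. It has exactness $m$ if $\sum_{j=1}^N w_jp(\mathbf{x}_j)=\int_{\mathbb{S}^d}p\,\mathrm{d}\omega_d$ for all $p\in\mathbb{P}_m(\mathbb{S}^d)$. Put $\langle f,g\rangle_N=\sum_{j=1}^N w_jf(\mathbf{x}_j)g(\mathbf{x}_j)$ for $f,g\in\mathcal{C}(\mathbb{S}^d)$.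 Hyperinterpolation class $\mathbf{HC}(\mathbb{S}^d)$: the operators $\mathcal{T}:\mathcal{C}(\mathbb{S}^d)\to\mathbb{P}_n(\mathbb{S}^d)$, for some $n$ such that the quadrature rule has exactness $2n$, of the form $\mathcal{T}f=\sum_{\ell=0}^n\sum_{k=1}^{Z(d,\ell)}\Phi\big(\langle f,Y^{(d)}_{\ell k}\rangle_N\big)Y^{(d)}_{\ell k}$, where $\Phi:\mathbb{R}\to\mathbb{R}$ is a (possibly nonlinear, possibly $(\ell,k)$-dependent) function, for which there exists $c_d>0$, independent of $n$, with $\|\mathcal{T}f\|_{L_2(\mathbb{S}^d)}\le c_d\|f\|_\infty$ for all $f\in\mathcal{C}(\mathbb{S}^d)$. (For a single operator this is the existence of a finite constant; independence of $n$ concerns families indexed by $n$.) Different operators may have different degrees $n$; the quadrature rule is the same. Operators are composed and added as maps $\mathcal{C}(\mathbb{S}^d)\to\mathcal{C}(\mathbb{S}^d)$; products denote composition. An operator $\mathcal{T}$ on $\mathcal{C}(\mathbb{S}^d)$ is hyper self-adjoint if $\langle\mathcal{T}f,g\rangle_N=\langle f,\mathcal{T}g\rangle_N$ for all $f,g\in\mathcal{C}(\mathbb{S}^d)$. It is a hyper projection operator if it is hyper self-adjoint and $\mathcal{T}^2=\mathcal{T}$. *)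

(* Defs.v *)
From HB Require Import structures.
From mathcomp Require Import all_boot all_order all_algebra.
From mathcomp.multinomials Require Import -(notations) mpoly.
From mathcomp Require Import all_classical all_reals all_analysis.
From mathcomp Require Import measurable_realfun.

Set Implicit Arguments.
Unset Strict Implicit.
Unset Printing Implicit Defensive.
Import Order.TTheory GRing.Theory Num.Theory numFieldNormedType.Exports.
Local Open Scope classical_set_scope.
Local Open Scope ring_scope.

Section image_measure.
Context d d' (T : measurableType d) (T' : measurableType d') (R : realType).
Context (m : {measure set T -> \bar R}) (f : {mfun T >-> T'}).

Definition image_measure : set T' -> \bar R := pushforward m f.

Let image_measure0 : image_measure set0 = 0%E.
Proof. exact: measure0. Qed.

Let image_measure_ge0 A : (0 <= image_measure A)%E.
Proof. exact: measure_ge0. Qed.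

Let image_measure_sigma_additive : semi_sigma_additive image_measure.
Proof. exact: measure_semi_sigma_additive. Qed.

HB.instance Definition _ := isMeasure.Build _ _ _ image_measure
  image_measure0 image_measure_ge0 image_measure_sigma_additive.

End image_measure.

(* Lebesgue measure on R^n, modelled as n.-tuple with the product
   sigma-algebra: the Dirac mass on the one-point space R^0, then the image of
   [lebesgue_measure \x lebesgue_measure_n n] under [(x, t) |-> x :: t]. *)
Section lebesgue_measure_n.
Context {R : realType}.
Local Notation Rn n := (n.-tuple (measurableTypeR R)).

Definition consT n (p : measurableTypeR R * Rn n) : Rn n.+1 :=
  [tuple of p.1 :: p.2].

Lemma measurable_consT n : measurable_fun setT (@consT n).
Proof. exact: (measurable_cons measurable_fst measurable_snd). Qed.

HB.instance Definition _ n :=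
  isMeasurableFun.Build _ _ _ _ (@consT n) (@measurable_consT n).

Section step.
Context (n : nat) (m : {sigma_finite_measure set (Rn n) -> \bar R}).

Definition lebesgue_step : set (Rn n.+1) -> \bar R :=
  image_measure ((@lebesgue_measure R) \x m)%E (@consT n).

HB.instance Definition _ := Measure.on lebesgue_step.

Let step_sigma_finite : sigma_finite setT lebesgue_step.
Proof.
have /sigma_finiteP[F [TF ndF Foo]] := sigma_finiteT (@lebesgue_measure R).
have /sigma_finiteP[G [TG ndG Goo]] := sigma_finiteT m.
pose g (t : Rn n.+1) : (measurableTypeR R * Rn n)%type :=
  (tnth t ord0, [tuple of behead t]).
have gK : cancel (@consT n) g by move=> [x t]; congr pair; apply/val_inj.
have mg : measurable_fun [set: Rn n.+1] g.
  apply: measurable_fun_pair; first exact: measurable_tnth.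
  exact: measurable_behead.
exists (fun k => g @^-1` (F k `*` G k)) => [|k].
  rewrite -preimage_bigcup (_ : \bigcup_k _ = setT) ?preimage_setT//.
  rewrite -setXTT TF TG; apply/seteqP; split=> [p [k _ [? ?]]|[x y] /= []].
    by split; exists k.
  move=> [i _ Fx] [j _ Gy]; exists (maxn i j) => //; split.
  - by move: x Fx; exact/subsetPset/ndF/leq_maxl.
  - by move: y Gy; exact/subsetPset/ndG/leq_maxr.
have [mF Fk] := Foo k; have [mG Gk] := Goo k; split.
  by rewrite -[X in measurable X]setTI; apply: mg => //; exact: measurableX.
rewrite /lebesgue_step /image_measure /pushforward -comp_preimage.
rewrite (_ : g \o (@consT n) = id) ?preimage_id; last exact/funext.
rewrite (_ : (_ < +oo)%E = (lebesgue_measure (F k) * m (G k) < +oo)%E).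
  by rewrite lte_mul_pinfty// ge0_fin_numE.
by congr (_ < _)%E; exact: product_measure1E.
Qed.

HB.instance Definition _ := Measure_isSigmaFinite.Build _ _ _ lebesgue_step
  step_sigma_finite.

End step.

Fixpoint lebesgue_measure_n n : {sigma_finite_measure set (Rn n) -> \bar R} :=
  match n with
  | 0 => \d_([tuple] : Rn 0)
  | n'.+1 => lebesgue_step (lebesgue_measure_n n')
  end.

End lebesgue_measure_n.

Definition sqnorm {R : realType} n (v : 'rV[R]_n) : R := \sum_i v 0 i ^+ 2.

Definition unit_vectors (R : realType) (d : nat) : set 'rV[R]_d.+1 :=
  [set v | sqnorm v = 1].
Arguments unit_vectors : clear implicits.

(* S^d in R^(d+1), with the topology induced by 'rV[R]_d.+1 and its Borel
   sigma-algebra. *)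
Definition sphere (R : realType) (d : nat) : Type :=
  set_type (unit_vectors R d).

Section sphere_structures.
Context {R : realType} {d : nat}.

HB.instance Definition _ := Choice.on (sphere R d).

Lemma pole_subproof : delta_mx 0 0 \in unit_vectors R d.
Proof.
apply/mem_set; rewrite /unit_vectors/= /sqnorm (bigD1 ord0)//= mxE !eqxx.
by rewrite expr1n big1 ?addr0// => i /negbTE i0; rewrite mxE i0 expr0n.
Qed.

Definition pole : sphere R d :=
  exist (fun v => is_true (v \in unit_vectors R d)) _ pole_subproof.

HB.instance Definition _ := isPointed.Build (sphere R d) pole.

HB.instance Definition _ := Topological.copy (sphere R d)
  (set_type (unit_vectors R d)).

HB.instance Definition _ := Measurable.copy (sphere R d)
  (g_sigma_algebraType (@open (sphere R d))).

Definition coord (x : sphere R d) : 'rV[R]_d.+1 := \val x.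

End sphere_structures.

Section surface_measure.
Context {R : realType} (d : nat).
Local Notation Rn n := (n.-tuple (measurableTypeR R)).

Definition row_of_tuple n (t : Rn n) : 'rV[R]_n := \row_i tnth t i.

Definition unit_ball : set (Rn d.+1) := [set t | sqnorm (row_of_tuple t) <= 1].

(* t / |t|; the value at t = 0 is an arbitrary point of the sphere. *)
Definition radial_proj (t : Rn d.+1) : sphere R d :=
  insubd (pole : set_type (unit_vectors R d))
    ((Num.sqrt (sqnorm (row_of_tuple t)))^-1 *: row_of_tuple t).

Lemma measurable_sqnorm n :
  measurable_fun setT (fun t : Rn n => sqnorm (row_of_tuple t)).
Proof.
apply: measurable_sum => i; apply: measurable_funX.
under eq_fun do rewrite mxE.
exact: (@measurable_tnth _ (measurableTypeR R) _ i).
Qed.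

Let measurable_ltc n (f : Rn n -> R) c :
  measurable_fun setT f -> measurable [set t | f t < c].
Proof.
move=> mf; rewrite (_ : mkset _ = f @^-1` [set` `]-oo, c[]).
  by rewrite -[X in measurable X]setTI; apply: mf => //; exact: measurable_itv.
by apply/seteqP; split => t /=; rewrite in_itv.
Qed.

Lemma measurable_unit_ball : measurable unit_ball.
Proof.
rewrite -[unit_ball]setTI.
rewrite (_ : unit_ball =
    (fun t => sqnorm (row_of_tuple t)) @^-1` [set` `]-oo, (1 : R)]]).
  by apply: measurable_sqnorm => //; exact: measurable_itv.
by apply/seteqP; split => t /=; rewrite /unit_ball/= in_itv.
Qed.

Lemma measurable_open_row n (W : set 'rV[R]_n) :
  open W -> measurable (@row_of_tuple n @^-1` W).
Proof.
move=> oW.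
pose slab i (q : rat) k : set (Rn n) :=
  [set t | `|(tnth t i : R) - ratr q| < k.+1%:R^-1].
have mslab i q k : measurable (slab i q k).
  apply: measurable_ltc.
  apply: (@measurableT_comp _ _ _ _ _ _ (@Num.norm R R)) => //.
  apply: measurable_funB => //.
  exact: (@measurable_tnth _ (measurableTypeR R) _ i).
pose box (p : 'rV[rat]_n * nat) : set (Rn n) :=
  \bigcap_(i in [set: 'I_n]) slab i (p.1 0 i) p.2.
have mbox p : measurable (box p) by exact: fin_bigcap_measurable.
rewrite (_ : _ @^-1` _ = \bigcup_k
    (if unpickle k is Some p then
       if `[< box p `<=` @row_of_tuple n @^-1` W >] then box p else set0
     else set0)).
  apply: bigcupT_measurable => k; case: unpickle => [p|]//.
  by case: ifPn.
apply/seteqP; split=> [t Wt|t [k _]]; last first.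
  by case: unpickle => [p|//]; case: asboolP => // + ?; exact.
have /nbhs_ballP[e /= e0 eW] : nbhs (row_of_tuple t) W by exact: open_nbhs_nbhs.
have [k ke] : exists k, k.+1%:R^-1 < e / 2.
  have e20 : 0 < e / 2 by rewrite divr_gt0.
  by have [k _ /(_ k (leqnn _))] := near_infty_natSinv_lt (PosNum e20); exists k.
have /choice[q hq] i : exists q : rat, `|(tnth t i : R) - ratr q| < k.+1%:R^-1.
  have tk : (tnth t i : R) - k.+1%:R^-1 < (tnth t i : R) + k.+1%:R^-1.
    by rewrite ltrD2l gtrN ?invr_gt0 ?ltr0n.
  have [q] := rat_in_itvoo tk.
  rewrite in_itv/= => /andP[q1 q2]; exists q.
  by rewrite distrC ltr_distl q1 q2.
exists (pickle (\row_i q i, k)) => //; rewrite pickleK asboolT.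
  by move=> i _ /=; rewrite /slab/= !mxE.
move=> u bu; apply: eW; split => // i j; rewrite !mxE.
have := bu j I; rewrite /slab/= mxE => uq.
rewrite -ball_normE/= (le_lt_trans (ler_distD (ratr (q j)) _ _))//.
rewrite [X in _ < X]splitr ltrD ?(lt_trans (hq j))//.
by rewrite distrC (lt_trans uq).
Qed.

Lemma measurable_radial_proj : measurable_fun setT radial_proj.
Proof.
pose nrm (t : Rn d.+1) : R := (Num.sqrt (sqnorm (row_of_tuple t)))^-1.
pose g (t : Rn d.+1) : Rn d.+1 :=
  [tuple (nrm t * (tnth t i : R) : measurableTypeR R) | i < d.+1].
have mg : measurable_fun setT g.
  apply/measurable_fun_tnthP => i.
  rewrite (_ : _ \o _ = fun t => nrm t * (tnth t i : R)); last first.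
    by apply/funext => t /=; rewrite tnth_mktuple.
  apply: measurable_funM; last exact: (@measurable_tnth _ (measurableTypeR R)).
  rewrite (_ : nrm = fun t => (sqnorm (row_of_tuple t) `^ 2^-1) `^ (-1)).
    apply: (@measurableT_comp _ _ _ _ _ _ (fun x : R => x `^ (-1))) => //.
    apply: (@measurableT_comp _ _ _ _ _ _ (fun x : R => x `^ 2^-1)) => //.
    exact: measurable_sqnorm.
  apply/funext => t; rewrite powR12_sqrt ?powR_inv1 ?sqrtr_ge0//.
  by apply: sumr_ge0 => j _; exact: sqr_ge0.
have gE t : row_of_tuple (g t) = nrm t *: row_of_tuple t.
  by apply/rowP => i; rewrite !mxE tnth_mktuple.
apply: (measurability (@open (sphere R d))) => // _ [V [W oW WV] <-].
pose N : set (Rn d.+1) := [set t | 0 < sqnorm (row_of_tuple t)].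
have mN : measurable N.
  rewrite (_ : N = [set t | - sqnorm (row_of_tuple t) < 0]).
    by apply: measurable_ltc; apply: measurableT_comp => //; exact: measurable_sqnorm.
  by apply/seteqP; split => t; rewrite /N/= oppr_lt0.
rewrite (_ : _ `&` _ = (N `&` g @^-1` (@row_of_tuple d.+1 @^-1` W)) `|`
    (~` N `&` (if `[< V pole >] then setT else set0))).
  apply: measurableU; apply: measurableI => //.
  - by rewrite -[X in measurable X]setTI; apply: mg => //; exact: measurable_open_row.
  - exact: measurableC.
  - by case: ifPn.
have sN t : N t -> coord (radial_proj t) = row_of_tuple (g t).
  rewrite /N/= => t0; rewrite /coord /radial_proj insubdK ?gE//.
  apply/mem_set; rewrite /unit_vectors/= /sqnorm.
  under eq_bigr do rewrite mxE exprMn.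
  by rewrite -mulr_sumr exprVn sqr_sqrtr ?ltW// mulVf// gt_eqF.
have sNC t : ~ N t -> radial_proj t = pole.
  rewrite /N/= => /negP; rewrite -leNgt => t0.
  rewrite /radial_proj ler0_sqrtr// invr0 scale0r /insubd insubF//.
  apply/negbTE/negP => /set_mem; rewrite /unit_vectors/= /sqnorm.
  rewrite big1 => [/esym/eqP|i _]; first by rewrite oner_eq0.
  by rewrite mxE expr0n.
have VW x : V x = W (coord x) by rewrite -WV.
apply/seteqP; split => t /=.
  move=> [_ Vt]; have [Nt|Nt] := pselect (N t).
    by left; split => //; rewrite -sN// -VW.
  by right; split => //; rewrite -(sNC _ Nt) asboolT.
move=> [[Nt Wt]|[Nt h]]; split => //; first by rewrite VW sN.
by rewrite sNC//; case: asboolP h.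
Qed.

HB.instance Definition _ := isMeasurableFun.Build _ _ _ _ radial_proj
  measurable_radial_proj.

(* omega_d as the cone measure: omega_d(A) is (d + 1) times the Lebesgue measure
   of { r x : x in A, 0 <= r <= 1 }. *)
Definition surface_measure : {measure set (sphere R d) -> \bar R} :=
  mscale (d.+1%:R%:nng) (image_measure
    (mrestr (@lebesgue_measure_n R d.+1) measurable_unit_ball) radial_proj).
End surface_measure.

Arguments surface_measure {R} d.

Definition Csphere (R : realType) (d : nat) : Type :=
  continuousType (sphere R d) R.

Section Csphere_lmodType.
Context {R : realType} {d : nat}.
Implicit Types f g h : Csphere R d.

HB.instance Definition _ := Choice.on (Csphere R d).

Let C0_cts : continuous (fun _ : sphere R d => 0 : R).
Proof. exact: cst_continuous. Qed.

Let CD_cts f g : continuous (fun x : sphere R d => f x + g x).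
Proof. by move=> x; exact: cvgD (@cts_fun _ _ f x) (@cts_fun _ _ g x). Qed.

Let CN_cts f : continuous (fun x : sphere R d => - f x).
Proof. by move=> x; exact: cvgN (@cts_fun _ _ f x). Qed.

Let CZ_cts (a : R) f : continuous (fun x : sphere R d => a * f x).
Proof. by move=> x; exact: cvgM (cvg_cst _) (@cts_fun _ _ f x). Qed.

Definition C0 : Csphere R d := mkcts C0_cts.
Definition CD f g : Csphere R d := mkcts (@CD_cts f g).
Definition CN f : Csphere R d := mkcts (@CN_cts f).
Definition CZ a f : Csphere R d := mkcts (@CZ_cts a f).

Let CDA : associative CD.
Proof. by move=> f g h; apply/continuousEP => x; exact: addrA. Qed.

Let CDC : commutative CD.
Proof. by move=> f g; apply/continuousEP => x; exact: addrC. Qed.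

Let C0D : left_id C0 CD.
Proof. by move=> f; apply/continuousEP => x; exact: add0r. Qed.

Let CND : left_inverse C0 CN CD.
Proof. by move=> f; apply/continuousEP => x; exact: addNr. Qed.

HB.instance Definition _ :=
  GRing.isZmodule.Build (Csphere R d) CDA CDC C0D CND.

Let CZA a b f : CZ a (CZ b f) = CZ (a * b) f.
Proof. by apply/continuousEP => x; exact: mulrA. Qed.

Let C1Z : left_id 1 CZ.
Proof. by move=> f; apply/continuousEP => x; exact: mul1r. Qed.

Let CZDr : right_distributive CZ +%R.
Proof. by move=> a f g; apply/continuousEP => x; exact: mulrDr. Qed.

Let CZDl f : {morph CZ^~ f : a b / a + b}.
Proof. by move=> a b; apply/continuousEP => x; exact: mulrDl. Qed.

HB.instance Definition _ :=
  GRing.Zmodule_isLmodule.Build R (Csphere R d) CZA C1Z CZDr CZDl.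

End Csphere_lmodType.

Section polynomials.
Context {R : realType} (d : nat).
Local Notation mpolyR := (mpoly d.+1 R).

Definition restricts_to (p : mpolyR) (f : Csphere R d) : Prop :=
  forall x : sphere R d, f x = meval (fun i => coord x 0 i) p.

(* [mpoly.msize p] is 1 + the total degree of p, and 0 for p = 0. *)
Definition sphere_poly (n : nat) : set (Csphere R d) :=
  [set f | exists2 p : mpolyR, (mpoly.msize p <= n.+1)%N & restricts_to p f].

Definition laplacian (p : mpolyR) : mpolyR :=
  \sum_i mderiv i (mderiv i p).

Definition spherical_harmonic (l : nat) : set (Csphere R d) :=
  [set f | exists p : mpolyR, [/\ p \is ishomog1 l mdeg,
    laplacian p = 0 & restricts_to p f]].

End polynomials.

Section hyperinterpolation.
Context {R : realType} {d : nat}.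
Local Notation S := (sphere R d).
Local Notation C := (Csphere R d).
Local Notation omega := (surface_measure d).

(* [Z l], the size of a basis, is the dimension Z(d, l). *)
Definition orthonormal_harmonic_basis (Z : nat -> nat)
    (Y : forall l, 'I_(Z l) -> C) : Prop :=
  forall l, [/\ forall k, spherical_harmonic l (Y l k),
    forall j k, \int[omega]_x (Y l j x * Y l k x) = (j == k)%:R &
    forall f, spherical_harmonic l f ->
      exists a : 'I_(Z l) -> R, f = \sum_k a k *: Y l k].

Record quadrature := Quadrature {
  qsize : nat;
  qnode : 'I_qsize -> S;
  qweight : 'I_qsize -> R;
  qweight_gt0 : forall j, 0 < qweight j }.

Definition qsum (Q : quadrature) (f : S -> R) : R :=
  \sum_j @qweight Q j * f (qnode j).

Definition exactness (Q : quadrature) (m : nat) : Prop :=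
  forall p : C, sphere_poly m p -> qsum Q p = \int[omega]_x p x.

Definition qdot (Q : quadrature) (f g : C) : R :=
  qsum Q (fun x => f x * g x).

Definition sup_norm (f : C) : R := sup [set `|f x| | x in [set: S]].

(* A single operator has a single degree n, so the independence of the bound
   from n reduces to the existence of a finite constant. *)
Definition HC (Q : quadrature) (Z : nat -> nat) (Y : forall l, 'I_(Z l) -> C)
    (T : C -> C) : Prop :=
  exists n : nat, [/\ exactness Q (2 * n),
    forall f, sphere_poly n (T f),
    exists Phi : forall l, 'I_(Z l) -> R -> R, forall f,
      T f = \sum_(l < n.+1) \sum_(k < Z l) Phi l k (qdot Q f (Y l k)) *: Y l k &
    exists2 c : R, 0 < c & forall f,
      ('N[omega]_2%:E[EFin \o T f] <= (c * sup_norm f)%:E)%E].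

Definition hyper_self_adjoint (Q : quadrature) (T : C -> C) : Prop :=
  forall f g, qdot Q (T f) g = qdot Q f (T g).

Definition hyper_projection (Q : quadrature) (T : C -> C) : Prop :=
  hyper_self_adjoint Q T /\ T \o T =1 T.

End hyperinterpolation.
Arguments quadrature : clear implicits.

(* Main.v *)
Require Import Defs.
From mathcomp Require Import all_boot all_order all_algebra.
From mathcomp Require Import all_classical all_reals all_analysis.
From mathcomp.multinomials Require Import -(notations) mpoly.
From mathcomp Require Import measurable_realfun zify ring lra.
Import Order.TTheory GRing.Theory Num.Theory numFieldNormedType.Exports.
Local Open Scope classical_set_scope.
Local Open Scope ring_scope.

(** The algebra is that of orthogonal projections. If [T1], [T2] are additive
    idempotents, expanding [(T1 + T2)^2] shows that the sum is idempotent iff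
    [T1 T2 + T2 T1 = 0]; multiplying this by [T1] on the left and on the right
    gives [T1 T2 = T2 T1], hence [2 T1 T2 = 0] ([idempotent_anticommuting]).
    Conversely, if [T1 T2 = 0] then [<T2 T1 f, g>_N = <f, T1 T2 g>_N = 0] for
    all [g], and so [T2 T1 = 0].

    Hyperinterpolation operators may be nonlinear, and the discrete form
    [<f, g>_N] is only semidefinite on continuous functions, so two facts have
    to be supplied. First, [<., .>_N] is definite on polynomials of degree at
    most [n] when the rule has exactness [2 n] ([qdot_definite]): the form at
    [(p, p)] is then the integral of [p^2] over the sphere, and a continuous
    nonnegative function of integral zero vanishes. Secondly, self-adjointness
    forces additivity ([hyper_self_adjoint_additive]): the defect
    [T (f + g) - (T f + T g)] is orthogonal to every function, in particular
    to itself, and it is a polynomial of degree at most [n].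

    The measure theory behind the first fact is that the surface measure is
    finite and charges every nonempty open set ([surface_measure_fin] and
    [surface_measure_open_gt0]). As a cone measure it is computed from
    Lebesgue measure in the ambient space, where both claims reduce to the
    volume of a cube. *)

(** * The volume of a cube *)

Section boxes.
Context {R : realType}.
Local Notation Rn n := (n.-tuple (measurableTypeR R)).

(** A ball of the sup norm, stated on tuples because Lebesgue measure is
    defined on them; [boxE] is the comparison with the topology of row vectors. *)
Definition box n (c : 'I_n -> R) (e : R) : set (Rn n) :=
  [set t | forall i, ball (c i) e (tnth t i : R)].

Lemma boxE n (c : 'I_n -> R) e : 0 < e ->
  box n c e = @row_of_tuple R n @^-1` ball (\row_i c i) e.
Proof.
move=> e0; apply/seteqP; split=> t /=.
  by move=> h; split=> // i j; rewrite !mxE; exact: h.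
by case=> _ h i; have := h 0 i; rewrite !mxE.
Qed.

Lemma measurable_box n (c : 'I_n -> R) e : 0 < e -> measurable (box n c e).
Proof.
by move=> e0; rewrite boxE//; apply: measurable_open_row; exact: ball_open.
Qed.

Lemma lebesgue_measure_box n (c : 'I_n -> R) e : 0 < e ->
  lebesgue_measure_n n (box n c e) = ((e *+ 2) ^+ n)%:E.
Proof.
move=> e0; elim: n c => [|n IHn] c; first by rewrite /= diracE mem_set// => -[].
rewrite [LHS]/= /lebesgue_step /image_measure /pushforward.
rewrite (_ : _ @^-1` _ = ball (c ord0) e `*` box n (c \o lift ord0) e).
  transitivity (lebesgue_measure (ball (c ord0) e) *
      lebesgue_measure_n n (box n (c \o lift ord0) e))%E.
    by apply: product_measure1E; [exact: measurable_ball|exact: measurable_box].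
  by rewrite IHn lebesgue_measure_ball ?ltW// exprS EFinM.
apply/seteqP; split=> [[x t]|[x t]] /=.
  move=> h; split=> [|i]; first exact: (h ord0).
  by have := h (lift ord0 i); rewrite tnthS.
move=> [hx ht] i; case: (unliftP ord0 i) => [j|] -> //.
by rewrite tnthS; exact: ht.
Qed.
End boxes.

(** * The surface measure is finite and charges open sets *)

Section surface.
Context {R : realType} {d : nat}.
Local Notation S := (sphere R d).
Local Notation Rn n := (n.-tuple (measurableTypeR R)).

Lemma sqnorm_coord (x : S) : sqnorm (Defs.coord x) = 1.
Proof. by have /set_mem := valP x. Qed.

Lemma ler_coord_sqnorm n (v : 'rV[R]_n) i : (v 0 i) ^+ 2 <= sqnorm v.
Proof.
rewrite /sqnorm (bigD1 i)//= lerDl; apply: sumr_ge0 => j _; exact: sqr_ge0.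
Qed.

Lemma sqnormZ n a (v : 'rV[R]_n) : sqnorm (a *: v) = a ^+ 2 * sqnorm v.
Proof.
by rewrite /sqnorm mulr_sumr; apply: eq_bigr => i _; rewrite mxE exprMn.
Qed.

Lemma sqnorm_continuous n : continuous (@sqnorm R n).
Proof.
rewrite /sqnorm; apply: (@continuous_big _ _ +%R).
  exact: pseudometric_normed_Zmodule.add_continuous.
move=> i _ v; apply: (@cvgM _ _ (nbhs v) _ _ _ (v 0 i) (v 0 i));
  exact: coord_continuous.
Qed.

(** The cone over the whole sphere is the unit ball, which lies in a cube. *)
Lemma surface_measure_fin : (surface_measure d [set: S] < +oo)%E.
Proof.
rewrite /= /mscale /image_measure /pushforward /= /mrestr.
rewrite preimage_setT setTI; apply: lte_mul_pinfty => //.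
apply: (@le_lt_trans _ _ (lebesgue_measure_n d.+1 (box d.+1 (fun=> 0) 2))).
  apply: le_measure; rewrite ?inE.
  - exact: measurable_unit_ball.
  - exact: measurable_box.
  move=> t /= tb i; have := ler_coord_sqnorm _ (row_of_tuple t) i.
  rewrite mxE => /le_trans/(_ tb) ti.
  rewrite -ball_normE/= sub0r normrN.
  rewrite -[_ < 2](@ltr_pXn2r _ 2)// ?nnegrE// real_normK ?num_real//.
  by apply: (le_lt_trans ti); lra.
by rewrite lebesgue_measure_box// ltry.
Qed.

(** The point [x / 2] is interior to the unit ball and radial projection is
    continuous there, so the cone over a neighbourhood of [x] contains a small
    cube centred at [x / 2]. *)
Lemma surface_measure_open_gt0 (U : set S) x :
  open U -> U x -> (0 < surface_measure d U)%E.
Proof.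
move=> [W oW WU] Ux.
have UW y : U y = W (Defs.coord y) by rewrite -WU.
pose v0 := 2^-1 *: Defs.coord x.
have n0 : sqnorm v0 = 4^-1.
  by rewrite /v0 sqnormZ sqnorm_coord; field.
pose h (v : 'rV[R]_d.+1) := (Num.sqrt (sqnorm v))^-1 *: v.
have hv0 : h v0 = Defs.coord x.
  rewrite /h n0 (_ : 4^-1 = 2^-1 ^+ 2 :> R); last by field.
  by rewrite sqrtr_sqr ger0_norm// /v0 scalerA invrK divff// scale1r.
have ch : h v @[v --> v0] --> h v0.
  apply: (@cvgZ R _ _ (nbhs v0) _ (fun v => (Num.sqrt (sqnorm v))^-1) id);
    last exact: cvg_id.
  apply: cvgV; first by rewrite n0 sqrtr_eq0 -ltNge invr_gt0.
  apply: continuous_comp; first exact: sqnorm_continuous.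
  exact: sqrt_continuous.
have nW : nbhs v0 [set v | W (h v)].
  have : nbhs (h v0) W by rewrite hv0; apply: open_nbhs_nbhs; split=> //; rewrite -UW.
  by move=> /ch.
have n01 : nbhs v0 [set v | 0 < sqnorm v < 1].
  have : nbhs (sqnorm v0) `]0, 1[%classic.
    apply: open_nbhs_nbhs; split; first exact: itv_open.
    by rewrite /= in_itv/= n0; lra.
  move=> /(@sqnorm_continuous _ v0).
  by apply: (@filterS _ (nbhs v0)) => v /=; rewrite in_itv.
have /nbhs_ballP[e /= e0 be] :
    nbhs v0 ([set v | W (h v)] `&` [set v | 0 < sqnorm v < 1]).
  exact: filterI.
have B0 : (0 < (d.+1%:R)%:E * lebesgue_measure_n d.+1 (box d.+1 (v0 0%R) e))%E.
  by rewrite lebesgue_measure_box// -EFinM lte_fin mulr_gt0// exprn_gt0//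
    mulrn_wgt0.
apply: (lt_le_trans B0).
rewrite /= /mscale /image_measure /pushforward /= /mrestr.
apply: lee_wpmul2l => //.
have mU : measurable U by apply: sub_sigma_algebra; exists W.
apply: le_measure; rewrite ?inE.
- exact: measurable_box.
- apply: measurableI; last exact: measurable_unit_ball.
  by rewrite -[X in measurable X]setTI; apply: measurable_radial_proj.
move=> t; rewrite boxE//= => bt.
have [|Wt /andP[t0 t1]] := be (row_of_tuple t).
  by move: bt; congr (ball _ _ _); apply/rowP => i; rewrite mxE.
split; last by rewrite /unit_ball/= ltW.
rewrite /= UW /Defs.coord /radial_proj insubdK//.
apply/mem_set; rewrite /unit_vectors/= sqnormZ exprVn sqr_sqrtr ?ltW//.
by rewrite mulVf// gt_eqF.
Qed.
End surface.

(** * Definiteness of the discrete form on polynomials *)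

Section definiteness.
Context {R : realType} {d : nat}.
Local Notation S := (sphere R d).
Local Notation C := (Csphere R d).
Local Notation omega := (surface_measure d).

Lemma open_preimage_Csphere (f : C) (A : set R) : open A -> open (f @^-1` A).
Proof. by move=> oA; move: A oA; apply/continuousP; exact: (@cts_fun _ _ f). Qed.

Lemma measurable_Csphere (f : C) : measurable_fun setT f.
Proof.
move=> mT; apply: (measurability _ (RGenOInfty.measurableE R)) => //.
move=> _ [_ [a ->] <-]; rewrite setTI; apply: sub_sigma_algebra.
by apply: open_preimage_Csphere; exact: interval_open.
Qed.

(** Coordinates of a unit vector are at most 1 in absolute value, so the sum of
    the absolute values of the coefficients is a bound. *)
Lemma sphere_poly_bounded n (f : C) :
  sphere_poly n f -> exists M : R, forall x, `|f x| <= M.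
Proof.
case=> p _ pf; exists (\sum_(m <- msupp p) `|mcoeff m p|) => x.
rewrite pf mevalE (le_trans (ler_norm_sum _ _ _))//; apply: ler_sum => m _.
rewrite normrM ler_piMr// normr_prod; apply: prodr_ile1 => i _.
rewrite normr_ge0 normrX exprn_ile1//=.
rewrite -[_ <= 1](@ler_pXn2r _ 2)// ?nnegrE// real_normK ?num_real// expr1n.
by rewrite -[leRHS](sqnorm_coord x) ler_coord_sqnorm.
Qed.

(** Where [f] is nonzero is an open set, of positive measure unless empty. The
    bound [M] matters: the real-valued integral of a function with infinite
    integral is 0 by convention, so integrability has to be known. *)
Lemma Rintegral_ge0_eq0 (f : C) (M : R) :
  (forall x, 0 <= f x <= M) -> \int[omega]_x f x = 0 -> f = 0.
Proof.
move=> f0M If0.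
have f0 x : 0 <= f x by have /andP[] := f0M x.
have intf : omega.-integrable setT (EFin \o f).
  apply: measurable_bounded_integrable => //.
  - exact: surface_measure_fin.
  - exact: measurable_Csphere.
  exists M; split=> [|N MN x _]; first exact: num_real.
  by rewrite /= ger0_norm// (le_trans _ (ltW MN))//; have /andP[] := f0M x.
have : (\int[omega]_x `|(EFin \o f) x|)%E = 0%E.
  transitivity (\int[omega]_x (EFin \o f) x)%E.
    by apply: eq_integral => x _ /=; rewrite ger0_norm.
  have /fineK <- := integral_fune_fin_num measurableT intf.
  by congr EFin.
move=> /(ae_eq_integral_abs _ measurableT (measurable_int _ intf))[A [mA A0 sA]].
apply/continuousEP => x /=; apply: contrapT => /eqP fx0.
pose U : set S := f @^-1` [set y | y != 0].
have oU : open U.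
  by apply: open_preimage_Csphere; exact: open_neq.
have : (omega U <= omega A)%E.
  apply: le_measure; rewrite ?inE//; first exact: sub_sigma_algebra.
  by move=> y yU; apply: sA => /= /(_ I) [] /eqP; exact/negP.
by rewrite A0 leNgt (surface_measure_open_gt0 U x).
Qed.

Fact Csphere_sqr_continuous (f : C) : continuous (fun x : S => f x * f x).
Proof. by move=> x; exact: cvgM (@cts_fun _ _ f x) (@cts_fun _ _ f x). Qed.

Definition Csphere_sqr (f : C) : C := mkcts (Csphere_sqr_continuous f).

Lemma sphere_poly_sqr n (f : C) : sphere_poly n f ->
  sphere_poly (2 * n) (Csphere_sqr f).
Proof.
case=> p pn pf; exists (p * p) => [|x]; last by rewrite mevalM -pf.
have [->|p0] := eqVneq p 0; first by rewrite mul0r msize0.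
rewrite msizeM//; move: pn; move: (mmeasure _ p) => k pn; lia.
Qed.

Lemma sphere_polyD n (f g : C) :
  sphere_poly n f -> sphere_poly n g -> sphere_poly n (f + g).
Proof.
move=> [p pn pf] [q qn qg]; exists (p + q) => [|x].
  by rewrite (leq_trans (msizeD_le _ _))// geq_max pn.
by rewrite mevalD -pf -qg.
Qed.

Lemma sphere_polyN n (f : C) : sphere_poly n f -> sphere_poly n (- f).
Proof.
by move=> [p pn pf]; exists (- p) => [|x]; rewrite ?msizeN// mevalN -pf.
Qed.

Variable Q : quadrature R d.

Lemma qdotDl f g h : qdot Q (f + g) h = qdot Q f h + qdot Q g h.
Proof.
rewrite /qdot /qsum -big_split/=; apply: eq_bigr => j _.
by rewrite -mulrDr -mulrDl.
Qed.

Lemma qdotC f g : qdot Q f g = qdot Q g f.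
Proof. by apply: eq_bigr => j _; rewrite [f _ * _]mulrC. Qed.

Lemma qdotNl f g : qdot Q (- f) g = - qdot Q f g.
Proof.
by rewrite /qdot /qsum -sumrN; apply: eq_bigr => j _; rewrite -mulrN -mulNr.
Qed.

Lemma qdot0r f : qdot Q f 0 = 0.
Proof. by apply: big1 => j _; rewrite mulr0 mulr0. Qed.

(** Exactness turns the form at [(f, f)] into the integral of [f^2], a
    polynomial of degree at most [2 n]. *)
Lemma qdot_definite n (f : C) : exactness Q (2 * n) -> sphere_poly n f ->
  qdot Q f f = 0 -> f = 0.
Proof.
move=> Qn fn f0; have [M fM] := sphere_poly_bounded n f fn.
have : Csphere_sqr f = 0.
  apply: (Rintegral_ge0_eq0 _ (M ^+ 2)) => [x|].
    rewrite (_ : Csphere_sqr f x = f x ^+ 2)// sqr_ge0/=.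
    by rewrite -real_normK ?num_real// lerXn2r ?nnegrE// (le_trans _ (fM x)).
  by rewrite -Qn//; exact: sphere_poly_sqr.
move=> /continuousEP f20; apply/continuousEP => x /=.
have : f x * f x == 0 by apply/eqP; exact: f20.
by rewrite mulf_eq0 orbb => /eqP.
Qed.

(** Adjointness moves [T] off the defect of additivity [h], so that [<h, h>_N]
    becomes [<f + g, T h>_N - <f, T h>_N - <g, T h>_N = 0]. *)
Lemma hyper_self_adjoint_additive n (T : C -> C) : exactness Q (2 * n) ->
  (forall f, sphere_poly n (T f)) -> hyper_self_adjoint Q T ->
  {morph T : f g / f + g}.
Proof.
move=> Qn Tn sT f g; apply/eqP; rewrite -subr_eq0; apply/eqP.
apply: (qdot_definite n) => //.
  by apply: sphere_polyD => //; apply: sphere_polyN; exact: sphere_polyD.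
set h := _ - _.
by rewrite {1}/h qdotDl qdotNl qdotDl !sT qdotDl subrr.
Qed.

End definiteness.

(** * Sums of projections *)

(** From [S T = - T S], composing with [S] on the left gives
    [S T = - S T S], and on the right [S T S = - T S]; so [S T = T S], while
    also [S T = - T S], and dividing by 2 concludes. *)
Lemma idempotent_anticommuting (R : numFieldType) (V : lmodType R)
    (S T : V -> V) : {morph S : f g / f + g} ->
  S \o S =1 S -> (forall f, S (T f) + T (S f) = 0) ->
  S \o T =1 fun=> 0.
Proof.
move=> SD SS anti f.
have S0 : S 0 = 0 by apply: (addrI (S 0)); rewrite -SD !addr0.
have ST h : S (T h) = - T (S h) by apply/eqP; rewrite -addr_eq0 anti.
have STS h : S (T (S h)) = - S (T h).
  by apply/eqP; rewrite -addr_eq0 -[X in _ + X]SS/= -SD addrC anti S0.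
have /= := STS f.
rewrite ST (SS f : S (S f) = S f) => /oppr_inj TSf.
have : 2 *: S (T f) = 0.
  by rewrite scaler_nat mulr2n {1}ST TSf addNr.
by move=> /eqP; rewrite scaler_eq0 pnatr_eq0 => /eqP.
Qed.

Lemma hyper_projection_sum (R : realType) (d n1 n2 : nat)
    (Q : quadrature R d) (T1 T2 : Csphere R d -> Csphere R d) :
  exactness Q (2 * n1) -> exactness Q (2 * n2) ->
  (forall f, sphere_poly n1 (T1 f)) -> (forall f, sphere_poly n2 (T2 f)) ->
  hyper_projection Q T1 -> hyper_projection Q T2 ->
  hyper_projection Q (fun f => T1 f + T2 f) <-> T1 \o T2 =1 (fun=> 0).
Proof.
move=> Q1 Q2 P1 P2 [s1 i1] [s2 i2].
have D1 := hyper_self_adjoint_additive Q n1 T1 Q1 P1 s1.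
have D2 := hyper_self_adjoint_additive Q n2 T2 Q2 P2 s2.
have sumE f : T1 (T1 f + T2 f) + T2 (T1 f + T2 f) =
    (T1 f + T2 f) + (T1 (T2 f) + T2 (T1 f)).
  rewrite D1 D2 (i1 f : T1 (T1 f) = _) (i2 f : T2 (T2 f) = _).
  by rewrite [T2 _ + T2 f]addrC addrACA.
split=> [[_ i12]|T120].
  apply: idempotent_anticommuting => // f.
  by apply: (addrI (T1 f + T2 f)); rewrite -sumE addr0; exact: i12.
have T210 f : T2 (T1 f) = 0.
  apply: (qdot_definite Q n2) => //.
  by rewrite s2 s1 (T120 _ : T1 (T2 _) = 0) qdot0r.
split=> [f g|f /=]; last by rewrite sumE (T120 f : T1 (T2 f) = 0) T210 !addr0.
by rewrite qdotDl s1 s2 ![qdot Q f _]qdotC -qdotDl.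
Qed.

Theorem theorem4p2 (R : realType) (d : nat) (hd : (2 <= d)%N)
    (Z : nat -> nat) (Y : forall l : nat, 'I_(Z l) -> Csphere R d)
    (hY : orthonormal_harmonic_basis Y)
    (Q : quadrature R d)
    (T1 T2 : Csphere R d -> Csphere R d)
    (hT1 : HC Q Y T1) (hT2 : HC Q Y T2)
    (hp1 : hyper_projection Q T1) (hp2 : hyper_projection Q T2) :
  (hyper_projection Q (fun f => T1 f + T2 f) <-> T1 \o T2 =1 (fun=> 0)) /\
  (hyper_projection Q (fun f => T1 f + T2 f) <-> T2 \o T1 =1 (fun=> 0)).
Proof.
have [n1 [Q1 P1 _ _]] := hT1; have [n2 [Q2 P2 _ _]] := hT2.
split; first exact: (hyper_projection_sum R d n1 n2).
rewrite (_ : (fun f => _) = fun f => T2 f + T1 f).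
  exact: (hyper_projection_sum R d n2 n1).
by apply/funext => f; rewrite addrC.
Qed.
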